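(* Let $\alpha\in(0,1)$ and let $g:\mathbb{R}_{\ge 0}\times\mathbb{R}^d\to\mathbb{R}^d$ satisfy: (1) $g$ is continuous; (2) $g(t,0)=0$ for all $t\ge 0$; (3) there is a constant $L>0$ such that $\|g(t,x)-g(t,y)\|\le L\|x-y\|$ for all $t\ge 0$ and $x,y\in\mathbb{R}^d$. Consider the fractional differential equation $$ {}^{C}D^{\alpha}_{0+}x(t)=g(t,x(t)),\quad t>0. $$ Then any nontrivial solution of this equation cannot decay to $0$ faster than $t^{-\alpha}$. More precisely, let $\Phi(\cdot,x_0)$ be an arbitrary solution with initial value $\Phi(0,x_0)=x_0\neq 0$ and let $\beta$ be an arbitrary positive number satisfying $\beta>\alpha$. Then $$ \limsup_{t\to+\infty} t^{\beta}\,\|\Phi(t,x_0)\|=+\infty. $$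
   Context: $\|\cdot\|$ is the Euclidean norm on $\mathbb{R}^d$. For $\alpha\in(0,1)$ the Riemann--Liouville integral is $I^{\alpha}_{0+}x(t)=\frac{1}{\Gamma(\alpha)}\int_0^t(t-\tau)^{\alpha-1}x(\tau)\,d\tau$, the Riemann--Liouville derivative is ${}^{R}D^{\alpha}_{0+}x(t)=\frac{d}{dt}(I^{1-\alpha}_{0+}x)(t)$, and the Caputo derivative is ${}^{C}D^{\alpha}_{0+}x(t)={}^{R}D^{\alpha}_{0+}(x(t)-x(0))$, taken componentwise for vector functions. Under the stated hypotheses on $g$, for every $x_0\in\mathbb{R}^d$ the initial value problem with $x(0)=x_0$ has a unique continuous solution $\Phi(\cdot,x_0)$ defined on all of $[0,\infty)$; a continuous function $x$ is a solution with $x(0)=x_0$ if and only if $x(t)=x_0+\frac{1}{\Gamma(\alpha)}\int_0^t(t-\tau)^{\alpha-1}g(\tau,x(\tau))\,d\tau$ for all $t\ge0$. *)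

(* Defs.v *)
From mathcomp Require Export all_boot all_order all_algebra.
From mathcomp Require Export all_classical all_reals all_analysis.

Set Implicit Arguments.
Unset Strict Implicit.
Unset Printing Implicit Defensive.

Export Order.TTheory GRing.Theory Num.Theory.
Export numFieldNormedType.Exports.

Local Open Scope classical_set_scope.
Local Open Scope ring_scope.

(* The library norm on 'rV[R]_d is the sup norm, hence this definition; the
   two norms induce the same topology. *)
Definition enorm (R : realType) (d : nat) (x : 'rV[R]_d) : R :=
  Num.sqrt (\sum_(i < d) (x ord0 i) ^+ 2).

Definition Gamma (R : realType) (a : R) : R :=
  \int[@lebesgue_measure R]_(t in `[0, +oo[) (t `^ (a - 1) * expR (- t)).

Section FractionalCalculus.
Context {R : realType}.
Implicit Types (alpha t : R) (f : R -> R).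

(* At the endpoint tau = t the kernel takes the value 0 `^ (alpha - 1) = 0 when
   alpha < 1; a single point does not affect the Lebesgue integral. *)
Definition RL_integral alpha f t : R :=
  (Gamma alpha)^-1 *
  \int[@lebesgue_measure R]_(tau in `[0, t]) ((t - tau) `^ (alpha - 1) * f tau).

(* [derive1] is total; existence of the derivative is the separate predicate
   [RL_derivable]. *)
Definition RL_derivable alpha f t : Prop :=
  derivable (RL_integral (1 - alpha) f) t 1.

Definition RL_derivative alpha f t : R :=
  derive1 (RL_integral (1 - alpha) f) t.

Definition caputo_derivable alpha f t : Prop :=
  RL_derivable alpha (fun s => f s - f 0) t.

Definition caputo_derivative alpha f t : R :=
  RL_derivative alpha (fun s => f s - f 0) t.

End FractionalCalculus.

Section VectorValued.
Context {R : realType} {d : nat}.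
Implicit Types (alpha t : R) (x : R -> 'rV[R]_d).

Definition caputo_derivable_vec alpha x t : Prop :=
  forall i : 'I_d, caputo_derivable alpha (fun s => x s ord0 i) t.

Definition caputo_derivative_vec alpha x t : 'rV[R]_d :=
  \row_(i < d) caputo_derivative alpha (fun s => x s ord0 i) t.

(* Functions on [0, +oo[ are represented by total functions on R whose values
   at negative arguments are irrelevant. *)
Definition caputo_solution alpha (g : R -> 'rV[R]_d -> 'rV[R]_d) x : Prop :=
  {within `[0, +oo[, continuous x} /\
  forall t, 0 < t ->
    caputo_derivable_vec alpha x t /\
    caputo_derivative_vec alpha x t = g t (x t).

End VectorValued.

(* Main.v *)
Require Import Defs.
From mathcomp Require Import measurable_realfun.
From mathcomp Require Import ring lra.

Local Open Scope classical_set_scope.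
Local Open Scope ring_scope.

(** The idea is to look at the equation before any derivative is inverted.
Write a = 1 - alpha and let y be the Riemann-Liouville integral of order a of
the scalar function f(t) = x_i(t) - x_i(0), for a solution x and a coordinate
i.  The Caputo equation says that y' = g_i(t, x(t)), and the Lipschitz condition
together with g(t, 0) = 0 bounds |y'(t)| by L |x(t)|.

Suppose that t^alpha |x(t)| tends to 0.  Then y'(t) = o(t^(a - 1)), and
comparing y with a multiple of t^a, whose derivative is a t^(a - 1), gives
y(t) = o(t^a) ([le_powR_derive1_near]).  On the other hand x(t) tends to 0, so
f(t) tends to - x_i(0); if x_i(0) != 0, then f keeps a constant sign and stays
away from 0 for large t, and since the kernel (t - tau)^(a - 1) is at least
t^(a - 1), the integral y(t) has size at least a constant times t * t^(a - 1) =
t^a ([powR_le_RL_integral_near]).  The two estimates are incompatible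
([RL_derivative_not_o]), hence x(0) = 0 ([caputo_solution_eq0]).

If the upper limit of t^beta |x(t)| were finite for some beta > alpha, then
t^alpha |x(t)| = O(t^(alpha - beta)) would tend to 0, which is the situation
just excluded when x(0) != 0.

Since Lebesgue integrals take default values on functions that are not
integrable, the lower bound on y requires that the singular kernel be integrable
and that Gamma(a) be finite and nonzero.  Both facts come from
[ge0_integral_oo_le], an upper bound for the integral of a function that may be
unbounded near both ends of an interval. *)

(** * Integrals of functions that are singular at the endpoints *)

(** The increments of a primitive F on the compact subintervals
[a + 1/(n+1), b - 1/(n+1)] are bounded by M, and monotone convergence carries
the bound over to the open interval.  A bound on increments, rather than limits
of F at the endpoints, is all that integrability needs. *)
Lemma ge0_integral_oo_le (R : realType) (f F : R -> R) (a b M : R) :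
  a < b ->
  {in `]a, b[, forall x, 0 <= f x} ->
  {in `]a, b[, continuous f} ->
  {in `]a, b[, forall x : R, is_derive x 1 F (f x)} ->
  (forall x y, a < x -> x <= y -> y < b -> F y - F x <= M) ->
  (\int[@lebesgue_measure R]_(x in `]a, b[) (f x)%:E <= M%:E)%E.
Proof.
move=> ab f0 cf dF FM.
pose e n : R := n.+1%:R^-1.
have e0 n : 0 < e n by rewrite invr_gt0.
pose S n : set R := `[a + e n, b - e n]%classic.
have Sab n : S n `<=` `]a, b[.
  move=> x; rewrite /S/= !in_itv/= => /andP[x1 x2]; have := e0 n.
  by move=> ?; apply/andP; split; lra.
have SE : \bigcup_n S n = `]a, b[%classic.
  apply/seteqP; split => [x [n _]|x]; first exact: Sab.
  rewrite /= in_itv/= => /andP[ax xb].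
  have m0 : 0 < Num.min (x - a) (b - x) by rewrite lt_min !subr_gt0 ax.
  have [n] : exists n, e n < Num.min (x - a) (b - x).
    have [n _ /(_ _ (leqnn n))] := near_infty_natSinv_lt (PosNum m0).
    by exists n.
  rewrite lt_min => /andP[n1 n2]; exists n => //.
  by rewrite /S/= in_itv/=; apply/andP; split; lra.
have mf : measurable_fun `]a, b[ f.
  by apply: open_continuous_measurable_fun => // x; rewrite inE; exact: cf.
have ndS : nondecreasing_seq S.
  move=> m n mn; rewrite subsetEset => x; rewrite /S/= !in_itv/=.
  have : e n <= e m by rewrite lef_pV2 ?posrE// ler_nat.
  by move=> nm /andP[x1 x2]; apply/andP; split; lra.
rewrite -SE.
have cvgS : (\int[@lebesgue_measure R]_(x in S n) (f x)%:E @[n --> \oo] -->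
    \int[@lebesgue_measure R]_(x in \bigcup_n S n) (f x)%:E)%E.
  apply: ge0_nondecreasing_set_cvg_integral => //.
  - by move=> n; exact: measurable_itv.
  - by move=> n; apply/measurable_EFinP; exact: measurable_funS (Sab n) mf.
  - by move=> n x /Sab xab; rewrite lee_fin f0.
rewrite -(cvg_lim _ cvgS)//; apply: lime_le.
  by apply/cvg_ex; eexists; exact: cvgS.
apply: nearW => n.
have M0 : 0 <= M.
  have := FM ((a + b) / 2) ((a + b) / 2).
  by rewrite subrr; apply => //; lra.
(* For small n the compact interval is empty or a single point. *)
have [le|lt] := leP (b - e n) (a + e n).
  rewrite /S; move: le; rewrite le_eqVlt => /predU1P[->|le].
    by rewrite set_itv1 integral_set1 lee_fin.
  by rewrite set_itv_ge ?integral_set0 ?lee_fin// -leNgt bnd_simp.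
have sub x : x \in `[a + e n, b - e n] -> x \in `]a, b[.
  by move=> xS; exact: (Sab n).
rewrite (@continuous_FTC2 _ f F)//.
- rewrite -EFinB lee_fin FM//; have := e0 n; lra.
- apply: continuous_in_subspaceT => x; rewrite inE => /sub; exact: cf.
- have cF : {within `[a + e n, b - e n], continuous F}.
    by apply: derivable_within_continuous => x /sub /dF [].
  have /(continuous_within_itvP _ lt) [_ ? ?] := cF; split => //.
  by move=> x /subset_itv_oo_cc/sub/dF[].
- move=> x /subset_itv_oo_cc/sub/dF d; rewrite derive1E; exact: derive_val.
Qed.

Lemma is_derive_powRB (R : realType) (a t x : R) : x < t ->
  is_derive x 1 (fun s : R => (t - s) `^ a) (- (a * (t - x) `^ (a - 1))).
Proof.
move=> xt; have tx : 0 < t - x by rewrite subr_gt0.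
have dB : is_derive x 1 (fun s : R => t - s) (- 1).
  by apply: is_derive_eq; rewrite add0r mul1r.
have := @is_derive1_comp _ (fun u => u `^ a) (fun s => t - s) _ _ _
  (is_derive1_powR a tx) dB.
by rewrite mulrN1.
Qed.

Lemma continuous_powRB (R : realType) (a t x : R) : x < t ->
  {for x, continuous (fun s : R => (t - s) `^ a)}.
Proof.
move=> xt; apply: differentiable_continuous; apply/derivable1_diffP.
by have [] := is_derive_powRB _ a _ _ xt.
Qed.

(** The primitive - (t - tau)^a / a of the kernel has increments at most
t^a / a. *)
Lemma integrable_RL_kernel (R : realType) (a t : R) : 0 < a -> 0 < t ->
  (@lebesgue_measure R).-integrable `[0, t]
    (EFin \o (fun tau => (t - tau) `^ (a - 1))).
Proof.
move=> a0 t0.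
have mk D : measurable_fun D (EFin \o (fun tau : R => (t - tau) `^ (a - 1))).
  apply: measurable_funTS; apply/measurable_EFinP.
  by apply: (measurableT_comp (measurable_powR _)); exact: measurable_funB.
apply/integrableP; split; first exact: mk.
under eq_integral do rewrite /= ger0_norm ?powR_ge0//.
rewrite -integral_itv_bndo_bndc; last exact: mk.
rewrite -integral_itv_obnd_cbnd; last exact: mk.
apply: (@le_lt_trans _ _ (t `^ a / a)%:E); last exact: ltry.
apply: (@ge0_integral_oo_le _ _ (fun tau => - a^-1 * (t - tau) `^ a)).
- exact: t0.
- by move=> x _; exact: powR_ge0.
- by move=> x; rewrite in_itv/= => /andP[_ xt]; exact: continuous_powRB.
- move=> x; rewrite in_itv/= => /andP[_ xt].
  have -> : (t - x) `^ (a - 1) = - a^-1 *: - (a * (t - x) `^ (a - 1)).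
    by rewrite scalerN scaleNr opprK /GRing.scale/= mulKf// gt_eqF.
  by apply: is_deriveZ; exact: is_derive_powRB.
- move=> x y x0 xy yt.
  have := powR_ge0 (t - y) a.
  have : (t - x) `^ a <= t `^ a by rewrite ge0_ler_powR ?nnegrE; lra.
  have : 0 < a^-1 by rewrite invr_gt0.
  nra.
Qed.

(** * Positivity of the Gamma function on ]0, 1] *)

(** The restriction to a <= 1 makes the cheapest comparisons work: the
integrand is at most t^(a - 1) on ]0, 1[ and at most e^(- t) on [1, +oo[, which
gives finiteness, while it is at least e^(- 1) on ]0, 1[, which gives
positivity. *)
Lemma Gamma_gt0 (R : realType) (a : R) : 0 < a -> a <= 1 -> 0 < Gamma a.
Proof.
move=> a0 a1; rewrite /Gamma /Rintegral; apply: fine_gt0.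
pose h (t : R) := t `^ (a - 1) * expR (- t).
rewrite -[X in (_ < X < _)%E]/(
  \int[lebesgue_measure]_(t in `[0%R, +oo[) (h t)%:E)%E.
have h0 t : 0 <= h t by rewrite mulr_ge0 ?powR_ge0 ?expR_ge0.
have me D : measurable_fun D (fun t : R => expR (- t)).
  by apply: measurable_funTS; apply: measurableT_comp.
have mh D : measurable_fun D (EFin \o h).
  apply: measurable_funTS; apply/measurable_EFinP.
  by apply: measurable_funM.
rewrite -integral_itv_obnd_cbnd; last exact: mh.
have h1 : (\int[@lebesgue_measure R]_(t in `]0%R, 1%R[) (h t)%:E
    <= (a^-1)%:E)%E.
  apply: (@le_trans _ _
    (\int[lebesgue_measure]_(t in `]0%R, 1%R[) (t `^ (a - 1))%:E)%E).
    apply: ge0_le_integral => //.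
    - by move=> t _; rewrite lee_fin.
    - exact: mh.
    - apply/measurable_EFinP; apply: measurable_funTS.
      exact: measurable_powR.
    move=> t; rewrite /= in_itv/= => /andP[t0 _].
    rewrite lee_fin ler_piMr ?powR_ge0//.
    by rewrite -expR0 ler_expR; lra.
  apply: (@ge0_integral_oo_le _ _ (fun t => a^-1 * t `^ a)).
  - exact: ltr01.
  - by move=> x _; exact: powR_ge0.
  - move=> x; rewrite in_itv/= => /andP[x0 _].
    apply: differentiable_continuous; apply/derivable1_diffP.
    by have [] := is_derive1_powR (a - 1) x0.
  - move=> x; rewrite in_itv/= => /andP[x0 _].
    have -> : x `^ (a - 1) = a^-1 *: (a * x `^ (a - 1)).
      by rewrite /GRing.scale/= mulKf// gt_eqF.
    by apply: is_deriveZ; exact: is_derive1_powR.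
  - move=> x y x0 xy y1.
    have := powR_ge0 x a.
    have : y `^ a <= 1.
      have <- : 1 `^ a = 1 :> R by rewrite powR1.
      by rewrite ge0_ler_powR ?nnegrE; lra.
    have : 0 < a^-1 by rewrite invr_gt0.
    nra.
have dNexpR (x : R) : is_derive x 1 (fun t : R => - expR (- t)) (expR (- x)).
  by apply: is_derive_eq; rewrite mulrN1 opprK.
have cNexpR (x : R) : {for x, continuous (fun t : R => expR (- t))}.
  by apply: continuous_comp; [exact: continuousN|exact: continuous_expR].
have h2 : (\int[@lebesgue_measure R]_(t in `[1%R, +oo[) (h t)%:E
    <= (expR (- 1))%:E)%E.
  apply: (@le_trans _ _
    (\int[lebesgue_measure]_(t in `[1%R, +oo[) (expR (- t))%:E)%E).
    apply: ge0_le_integral => //.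
    - by move=> t _; rewrite lee_fin.
    - exact: mh.
    - by apply/measurable_EFinP; exact: me.
    move=> t; rewrite /= in_itv/= andbT => t1.
    rewrite lee_fin ler_piMl ?expR_ge0//.
    by rewrite -[leRHS](powRr0 t) ler_powR//; lra.
  rewrite (@ge0_continuous_FTC2y _ _ (fun t => - expR (- t)) _ 0).
  - by rewrite EFinN oppeK add0e.
  - by move=> x _; exact: expR_ge0.
  - by apply: continuous_subspaceT => x; exact: cNexpR.
  - by rewrite -oppr0; apply: cvgN; exact: cvgr_expR.
  - by move=> x _; have [] := dNexpR x.
  - by apply: cvg_at_right_filter; apply: cvgN; exact: cNexpR.
  - by move=> x _; rewrite derive1E; exact: derive_val.
have hpos : (0 < \int[@lebesgue_measure R]_(t in `]0%R, 1%R[) (h t)%:E)%E.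
  apply: (@lt_le_trans _ _
    (\int[@lebesgue_measure R]_(t in `]0%R, 1%R[) (expR (- 1))%:E)%E).
    rewrite integral_cst//= lebesgue_measure_itv/= lte01 sube0 mule1.
    by rewrite lte_fin expR_gt0.
  apply: ge0_le_integral => //.
  - exact: mh.
  move=> t; rewrite /= in_itv/= => /andP[t0 t1].
  rewrite lee_fin -[leLHS]mul1r ler_pM ?expR_ge0 ?ler_expR//; last lra.
  by rewrite -[leLHS](powRr0 t) ger_powR//; lra.
rewrite (@itv_bndbnd_setU _ _ _ (BLeft 1)) ?bnd_simp//.
rewrite ge0_integral_setU//=.
- apply/andP; split.
  + rewrite (lt_le_trans hpos)// leeDl// integral_ge0// => x _.
    by rewrite lee_fin.
  + by rewrite (le_lt_trans (leeD h1 h2))// -EFinD ltry.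
- exact: mh.
- by move=> x _; rewrite lee_fin.
- apply/disj_setPS => x [] /=; rewrite !in_itv/= andbT => /andP[_ x1].
  by move=> /(lt_le_trans x1); rewrite ltxx.
Qed.

(** * Riemann-Liouville integrals of continuous functions *)

Lemma integrable_RL_integrand (R : realType) (a t : R) (f : R -> R) :
  0 < a -> 0 < t -> {within `[0, +oo[, continuous f} ->
  (@lebesgue_measure R).-integrable `[0, t]
    (EFin \o (fun tau => (t - tau) `^ (a - 1) * f tau)).
Proof.
move=> a0 t0 cf.
have cft : {within `[0, t], continuous f}.
  by apply: continuous_subspaceW cf; exact: subset_itvl.
have bf : [bounded f x | x in `[0, t]].
  have /compact_bounded[M [_ mrt]] :=
    continuous_compact cft (@segment_compact _ 0 t).
  by exists M; split; rewrite ?num_real // => ? ? ? ?; exact: mrt.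
have mf : measurable_fun `[0, t] f.
  by apply: subspace_continuous_measurable_fun; [exact: measurable_itv|].
apply: (integrableMl _ (integrable_RL_kernel _ _ _ a0 t0) mf bf).
exact: measurable_itv.
Qed.

Lemma RL_integralN (R : realType) (a t : R) (f : R -> R) :
  0 < a -> 0 < t -> {within `[0, +oo[, continuous f} ->
  RL_integral a (fun s => - f s) t = - RL_integral a f t.
Proof.
move=> a0 t0 cf; rewrite /RL_integral -mulrN; congr (_ * _).
rewrite -[RHS]mulN1r -RintegralZl//; last exact: integrable_RL_integrand.
by apply: eq_Rintegral => s _; rewrite mulN1r mulrN.
Qed.

(** * Comparison with powers near infinity *)

Lemma powR_ge_near (R : realType) (a B : R) : 0 < a ->
  \forall t \near +oo, B <= t `^ a.
Proof.
move=> a0; near=> t.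
have B0 : 0 <= Num.max B 0 by rewrite le_max lexx orbT.
have Bt : (Num.max B 0) `^ a^-1 <= t.
  by near: t; apply: nbhs_pinfty_ge; exact: num_real.
apply: (@le_trans _ _ (Num.max B 0)); first by rewrite le_max lexx.
rewrite -[leLHS]powRr1// -(mulVf (lt0r_neq0 a0)) powRrM.
by rewrite ge0_ler_powR ?nnegrE ?powR_ge0 ?(ltW a0)// (le_trans _ Bt) ?powR_ge0.
Unshelve. all: by end_near. Qed.

Lemma powR_antitone (R : realType) (b x y : R) : b <= 0 -> 0 < x -> x <= y ->
  y `^ b <= x `^ b.
Proof.
move=> b0 x0 xy; rewrite -[b]opprK !(powRN _ (- b)) lef_pV2 ?posrE ?powR_gt0//.
  by rewrite ge0_ler_powR ?nnegrE; lra.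
lra.
Qed.

(** The function e s^a - y(s) is nondecreasing from some point T on, so
y(t) - e t^a is bounded above by a constant, which e t^a exceeds for large t;
this is where the factor 2 comes from. *)
Lemma le_powR_derive1_near (R : realType) (a e : R) (y : R -> R) :
  0 < a -> 0 < e ->
  (forall t : R, 0 < t -> derivable y t 1) ->
  (\forall t \near +oo, derive1 y t <= e * (a * t `^ (a - 1))) ->
  \forall t \near +oo, y t <= 2 * e * t `^ a.
Proof.
move=> a0 e0 dy [T0 [_ yT0]].
pose T := Num.max T0 0 + 1.
have [T00 T1] : T0 < T /\ 0 < T.
  have : T0 <= Num.max T0 0 by rewrite le_max lexx.
  have : 0 <= Num.max T0 0 by rewrite le_max lexx orbT.
  by rewrite /T; split; lra.
near=> t.
have Tt : T < t by near: t; apply: nbhs_pinfty_gt; exact: num_real.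
have ty : y T / e <= t `^ a by near: t; exact: powR_ge_near.
pose h := (fun s : R => e * s `^ a - y s).
have dh (s : R) : 0 < s ->
    is_derive s 1 h (e * (a * s `^ (a - 1)) - derive1 y s).
  move=> s0; apply: is_deriveB.
    by apply: is_deriveZ; exact: is_derive1_powR.
  by rewrite derive1E; apply/derivableP; exact: dy.
have hT : h T <= h t.
  have H := @ger0_derive1_le_cc _ h T t.
  apply: H => //; rewrite ?in_itv/= ?lexx ?(ltW Tt)//.
  - move=> s; rewrite in_itv/= => /andP[Ts _].
    by have [] := dh s (lt_trans T1 Ts).
  - move=> s; rewrite in_itv/= => /andP[Ts _].
    have d := dh s (lt_trans T1 Ts).
    by rewrite derive1E derive_val subr_ge0 yT0// (lt_trans T00).
  - apply: derivable_within_continuous => s; rewrite in_itv/= => /andP[Ts _].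
    by have [] := dh s (lt_le_trans T1 Ts).
have : y T <= e * t `^ a by rewrite mulrC -ler_pdivrMr.
have : 0 <= e * T `^ a by rewrite mulr_ge0 ?powR_ge0// ltW.
by move: hT; rewrite /h; lra.
Unshelve. all: by end_near. Qed.

(** Let f >= c beyond T and f >= - K on [0, T].  For large t the part of the
integral over [0, T] is at least - K T because the kernel is at most 1 there,
and the part over ]T, t[ is at least c t^(a - 1) (t - T) because the kernel is
at least t^(a - 1).  The sum is c t^a up to a bounded error, which half of
c t^a absorbs. *)
Lemma powR_le_RL_integral_near (R : realType) (a c : R) (f : R -> R) :
  0 < a -> a <= 1 -> 0 < c -> {within `[0, +oo[, continuous f} ->
  (\forall t \near +oo, c <= f t) ->
  \forall t \near +oo, (Gamma a)^-1 * (c / 2 * t `^ a) <= RL_integral a f t.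
Proof.
move=> a0 a1 c0 cf [T0 [_ fT0]].
pose T := Num.max T0 0 + 1.
have [T00 T1] : T0 < T /\ 1 <= T.
  have : T0 <= Num.max T0 0 by rewrite le_max lexx.
  have : 0 <= Num.max T0 0 by rewrite le_max lexx orbT.
  by rewrite /T; split; lra.
have T_ge0 : 0 <= T by lra.
have [K K0 fK] : exists2 K, 0 <= K & forall s, 0 <= s -> s <= T -> - K <= f s.
  have cfT : {within `[0, T], continuous f}.
    by apply: continuous_subspaceW cf; exact: subset_itvl.
  have [s0 _ fs0] := EVT_min T_ge0 cfT.
  exists `|f s0| => // s s_ge0 sT; apply: le_trans (fs0 s _).
    by rewrite lerNl -normrN ler_norm.
  by rewrite in_itv/= s_ge0.
near=> t.
(* The margin 1 keeps the kernel at most 1 on [0, T]. *)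
have Tt : T + 1 < t by near: t; apply: nbhs_pinfty_gt; exact: num_real.
(* The threshold at which c / 2 * t `^ a absorbs c * T + K * T. *)
have tB : 2 / c * (c * T + K * T) <= t `^ a by near: t; exact: powR_ge_near.
have t0 : 0 < t by lra.
rewrite /RL_integral ler_pM2l ?invr_gt0 ?Gamma_gt0//.
set k := fun tau => (t - tau) `^ (a - 1) * f tau.
have ik := integrable_RL_integrand _ _ _ _ a0 t0 cf.
have sub1 : `[0, T] `<=` `[0, t] by apply: subset_itvl; rewrite bnd_simp; lra.
have sub2 : `]T, t[ `<=` `[0, t].
  by apply: subset_itv; rewrite bnd_simp; lra.
(* For a < 1 the kernel is 0 at tau = t, below its bound elsewhere. *)
rewrite -Rintegral_itv_bndo_bndc; last first.
  by apply: integrableS ik => //; apply: subset_itvl; rewrite bnd_simp.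
have UE : `[0, t[%classic = `[0, T] `|` `]T, t[.
  by rewrite -itv_bndbnd_setU// bnd_simp; lra.
have icst r : (@lebesgue_measure R).-integrable `[0, t] (EFin \o cst r).
  apply: continuous_compact_integrable; first exact: segment_compact.
  by apply: continuous_subspaceT => x; exact: cst_continuous.
rewrite UE Rintegral_setU//=; last 2 first.
  rewrite -UE; apply: integrableS ik => //.
  by apply: subset_itvl; rewrite bnd_simp.
  apply/disj_setPS => s [] /=; rewrite !in_itv/= => /andP[_ sT] /andP[Ts _].
  by move: (le_lt_trans sT Ts); rewrite ltxx.
have I1 : - K * T <= \int[lebesgue_measure]_(s in `[0, T]) k s.
  apply: (@le_trans _ _ (\int[@lebesgue_measure R]_(s in `[0, T]) (- K))).
    rewrite Rintegral_cst//= lebesgue_measure_itv/= lte_fin.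
    by case: ifPn => //=; lra.
  apply: le_Rintegral => //.
  - exact: integrableS (icst (- K)).
  - by apply: integrableS ik.
  - move=> s; rewrite /= in_itv/= => /andP[s_ge0 sT].
    have k0 := powR_ge0 (t - s) (a - 1).
    have k1 : (t - s) `^ (a - 1) <= 1.
      by rewrite -[leRHS](powRr0 (t - s)) ler_powR//; lra.
    have := fK s s_ge0 sT; rewrite /k; nra.
have I2 : c * t `^ (a - 1) * (t - T) <=
    \int[lebesgue_measure]_(s in `]T, t[) k s.
  apply: (@le_trans _ _
    (\int[@lebesgue_measure R]_(s in `]T, t[) (c * t `^ (a - 1)))).
    rewrite Rintegral_cst//= lebesgue_measure_itv/= lte_fin.
    by case: ifPn => //=; lra.
  apply: le_Rintegral => //.
  - exact: integrableS (icst (c * t `^ (a - 1))).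
  - by apply: integrableS ik.
  - move=> s; rewrite /= in_itv/= => /andP[Ts st].
    rewrite mulrC ler_pM ?powR_ge0//; first lra.
      by apply: powR_antitone; lra.
    by apply: fT0; lra.
have tE : t * t `^ (a - 1) = t `^ a by rewrite mulr_powRB1 ?ltW.
have t1 : t `^ (a - 1) <= 1.
  by rewrite -[leRHS](powRr0 t) ler_powR//; lra.
have cTK : c * T + K * T <= c / 2 * t `^ a.
  have -> : c * T + K * T = c / 2 * (2 / c * (c * T + K * T)).
    by field; exact: lt0r_neq0.
  by rewrite ler_wpM2l//; lra.
have : c * T * t `^ (a - 1) <= c * T by rewrite ler_piMr// mulr_ge0// ltW.
move: I1 I2; rewrite mulrBr -(mulrA c _ t) (mulrC _ t) tE (mulrAC c _ T).
lra.
Unshelve. all: by end_near. Qed.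

(** A one-sided bound on the derivative suffices, since f has a sign: the
integral is at least a fixed multiple of t^a, whereas the bound on its
derivative allows only arbitrarily small multiples. *)
Lemma RL_derivative_not_o (R : realType) (a c : R) (f : R -> R) :
  0 < a -> a <= 1 -> 0 < c -> {within `[0, +oo[, continuous f} ->
  (\forall t \near +oo, c <= f t) ->
  (forall t : R, 0 < t -> derivable (RL_integral a f) t 1) ->
  ~ (forall e : R, 0 < e ->
      \forall t \near +oo, derive1 (RL_integral a f) t <= e * t `^ (a - 1)).
Proof.
move=> a0 a1 c0 cf fc dI oI.
have G0 := Gamma_gt0 _ _ a0 a1.
(* The lower bound is 4 e t^a, the upper one 2 e t^a. *)
pose e := (Gamma a)^-1 * (c / 8).
have e0 : 0 < e by rewrite mulr_gt0 ?invr_gt0// divr_gt0.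
have upper : \forall t \near +oo, RL_integral a f t <= 2 * e * t `^ a.
  apply: le_powR_derive1_near => //.
  have := oI (e * a) (mulr_gt0 e0 a0).
  by under eq_near do rewrite -mulrA.
have lower := powR_le_RL_integral_near _ _ _ _ a0 a1 c0 cf fc.
have [t [[up lo] t0]] := filter_ex
  (filterI (filterI upper lower) (nbhs_pinfty_gt (num_real 0))).
have ta : 0 < t `^ a by exact: powR_gt0.
have : (Gamma a)^-1 * (c / 2 * t `^ a) <= 2 * e * t `^ a by exact: le_trans up.
have -> : (Gamma a)^-1 * (c / 2 * t `^ a) = 4 * e * t `^ a.
  by rewrite /e; field; exact: lt0r_neq0.
rewrite ler_pM2r// ler_pM2r//; lra.
Qed.

(** * Decay of solutions *)

Lemma ler_abs_enorm (R : realType) (d : nat) (x : 'rV[R]_d) (i : 'I_d) :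
  `|x ord0 i| <= enorm x.
Proof.
rewrite /enorm -sqrtr_sqr ler_wsqrtr// (bigD1 i)//= lerDl sumr_ge0// => j _.
exact: sqr_ge0.
Qed.

(** Linear growth of g turns the decay of x into decay of the derivative of the
fractional integral; the scalar argument then applies to each coordinate of
x(t) - x(0), or to its opposite when that coordinate of x(0) is positive. *)
Lemma caputo_solution_eq0 (R : realType) (d : nat) (alpha L : R)
    (g : R -> 'rV[R]_d -> 'rV[R]_d) (x : R -> 'rV[R]_d) :
  0 < alpha < 1 -> 0 < L ->
  (forall t y, 0 <= t -> enorm (g t y) <= L * enorm y) ->
  caputo_solution alpha g x ->
  t `^ alpha * enorm (x t) @[t --> +oo] --> 0 ->
  x 0 = 0.
Proof.
move=> /andP[al0 al1] L0 gL [cx sx] x_o.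
have x_small e : 0 < e -> \forall t \near +oo, t `^ alpha * enorm (x t) <= e.
  move=> e0; near=> t; apply: (le_trans (ler_norm _)).
  rewrite -normrN -sub0r; near: t.
  by move/cvgrPdist_le : x_o; apply.
apply/rowP => i; rewrite mxE; apply/eqP/negPn/negP => xi0.
pose f s := x s ord0 i - x 0 ord0 i.
have cf : {within `[0, +oo[, continuous f}.
  have cxi : {within `[0, +oo[, continuous (fun s => x s ord0 i)}.
    move=> s.
    exact: (continuous_comp (cx s) (@coord_continuous R 1 d ord0 i (x s))).
  by move=> s; apply: continuousB; [exact: cxi|exact: cst_continuous].
have dI t : 0 < t -> derivable (RL_integral (1 - alpha) f) t 1.
  by move=> /sx[/(_ i) + _].
have DI t : 0 < t -> derive1 (RL_integral (1 - alpha) f) t = g t (x t) ord0 i.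
  by move=> /sx[_ <-]; rewrite mxE.
have oDI e : 0 < e -> \forall t \near +oo,
    `|derive1 (RL_integral (1 - alpha) f) t| <= e * t `^ (1 - alpha - 1).
  move=> e0; near=> t.
  have t0 : 0 < t by near: t; apply: nbhs_pinfty_gt; exact: num_real.
  rewrite DI//; apply: (le_trans (ler_abs_enorm _ _ _ _)).
  apply: (le_trans (gL _ _ (ltW t0))).
  rewrite (_ : 1 - alpha - 1 = - alpha); last by ring.
  rewrite powRN ler_pdivlMr ?powR_gt0// -mulrA -ler_pdivlMl//.
  rewrite mulrC [leRHS]mulrC.
  by near: t; apply: x_small; rewrite divr_gt0.
have xi_small e : 0 < e -> \forall t \near +oo, `|x t ord0 i| <= e.
  move=> e0; near=> t; apply: (le_trans (ler_abs_enorm _ _ _ _)).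
  apply: (@le_trans _ _ (t `^ alpha * enorm (x t))).
    rewrite ler_peMl ?sqrtr_ge0//.
    by near: t; exact: powR_ge_near.
  by near: t; exact: x_small.
have a0 : 0 < 1 - alpha by lra.
have a1 : 1 - alpha <= 1 by lra.
pose c := `|x 0 ord0 i| / 2.
have c0 : 0 < c by rewrite divr_gt0// normr_gt0.
have [x0_lt0|x0_ge0] := ltP (x 0 ord0 i) 0.
- apply: (@RL_derivative_not_o _ _ c f a0 a1 c0 cf _ dI).
    near=> t.
    have : `|x t ord0 i| <= c by near: t; exact: xi_small.
    by rewrite /f ler_norml /c ltr0_norm//; lra.
  move=> e e0; near=> t; apply: (le_trans (ler_norm _)).
  by near: t; exact: oDI.
- have IN t : 0 < t ->
    RL_integral (1 - alpha) (fun s => - f s) t = - RL_integral (1 - alpha) f t.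
    by move=> t0; exact: RL_integralN.
  have dIN (t : R) : 0 < t ->
      is_derive t 1 (RL_integral (1 - alpha) (fun s => - f s))
        (- derive1 (RL_integral (1 - alpha) f) t).
    move=> t0; have dt : is_derive t 1 (- RL_integral (1 - alpha) f)
        (- derive1 (RL_integral (1 - alpha) f) t).
      by apply: is_deriveN; rewrite derive1E; apply/derivableP; exact: dI.
    apply: (near_eq_is_derive _ dt).
    by near=> s; apply/esym/IN; near: s; exact: lt_nbhsr.
  apply: (@RL_derivative_not_o _ _ c (fun s => - f s) a0 a1 c0 _).
  + by move=> s; apply: continuousN; exact: cf.
  + near=> t.
    have : `|x t ord0 i| <= c by near: t; exact: xi_small.
    by rewrite /f ler_norml /c ger0_norm//; lra.
  + by move=> t /dIN[].
  + move=> e e0; near=> t.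
    have t0 : 0 < t by near: t; apply: nbhs_pinfty_gt; exact: num_real.
    have dt := dIN t t0; rewrite derive1E derive_val.
    by rewrite lerNl lerNnormlW//; near: t; exact: oDI.
Unshelve. all: by end_near. Qed.

Theorem theorem6 (R : realType) (d : nat) (alpha : R)
    (g : R -> 'rV[R]_d -> 'rV[R]_d)
    (halpha : 0 < alpha < 1)
    (hcont : {within `[0, +oo[ `*` [set: 'rV[R]_d],
                continuous (fun p : R * 'rV[R]_d => g p.1 p.2)})
    (hzero : forall t : R, 0 <= t -> g t 0 = 0)
    (hlip : exists L : R, 0 < L /\
       forall (t : R) (x y : 'rV[R]_d), 0 <= t ->
         enorm (g t x - g t y) <= L * enorm (x - y))
    (x0 : 'rV[R]_d) (hx0 : x0 != 0)
    (Phi : R -> 'rV[R]_d)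
    (hsol : caputo_solution alpha g Phi)
    (hinit : Phi 0 = x0)
    (beta : R) (hbeta0 : 0 < beta) (hbeta : alpha < beta) :
  limf_esup (fun t : R => (t `^ beta * enorm (Phi t))%:E) +oo%R = +oo%E.
Proof.
have [L [L0 gL]] := hlip.
rewrite limf_esupE; apply/eqP; apply: contraT => noty.
have [C PhiC] : exists C : R,
    \forall t \near +oo, t `^ beta * enorm (Phi t) <= C.
  have : (ereal_inf [set ereal_sup [set (t `^ beta * enorm (Phi t))%:E | t in V]
      | V in +oo%R] < +oo)%E by rewrite lt_neqAle noty leey.
  move=> /ereal_inf_lt[_ [V Voo <-]] supV.
  exists (fine (ereal_sup [set (t `^ beta * enorm (Phi t))%:E | t in V])).
  apply: filterS Voo => t Vt.
  have := ereal_sup_ubound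
    (imageP (fun t => (t `^ beta * enorm (Phi t))%:E) Vt).
  by case: ereal_sup supV.
case/eqP : hx0; rewrite -hinit.
apply: (@caputo_solution_eq0 _ _ alpha L g) => //.
  by move=> t y t0; have := gL t y 0 t0; rewrite hzero// !subr0.
apply/cvgrPdist_le => e e0; near=> t.
have t0 : 0 < t by near: t; apply: nbhs_pinfty_gt; exact: num_real.
rewrite sub0r normrN ger0_norm ?mulr_ge0 ?powR_ge0 ?sqrtr_ge0//.
have C1 : t `^ beta * enorm (Phi t) <= C by near: t; exact: PhiC.
have C2 : C / e <= t `^ (beta - alpha) by near: t; apply: powR_ge_near; lra.
rewrite -(ler_pM2r (powR_gt0 (beta - alpha) t0)) mulrAC -powRD; last first.
  by rewrite (gt_eqF t0) implybT.
rewrite (_ : alpha + (beta - alpha) = beta); last by ring.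
by apply: (le_trans C1); rewrite mulrC -ler_pdivrMr.
Unshelve. all: by end_near. Qed.
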